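(* Let $\Bbbk$ be a field of characteristic zero, let $\mathcal{O}=\mathcal{P}(E,R)=\mathcal{F}(E)/(R)$ be a quadratic Koszul graded operad over $\Bbbk$, with $E$ a reduced graded $\mathbb{S}$-module, and let $\Gamma=\sum(\mu^{(1)}\circ_l\mu^{(2)})\cdot\sigma\in R(r)$ be a relation of arity $r$, with a fixed such presentation. Let $A$ be a DG-$\mathcal{O}$-algebra with differential $d$, and let $x_1,\dots,x_r\in H_*(A)$ be homogeneous elements such that $\mu^{(2)}(x_{\sigma^{-1}(l)},\dots,x_{\sigma^{-1}(l+r_2-1)})=0$ in $H_*(A)$ for each summand of $\Gamma$. For each $i$ choose a cycle $y_i\in A_{|x_i|}$ representing $x_i$, and for each summand of $\Gamma$ choose an element $\rho^{(2)}\in A$ of degree $|\mu^{(2)}|+\sum_{i=1}^{r_2}|x_{\sigma^{-1}(l+i-1)}|+1$ with $d(\rho^{(2)})=\mu^{(2)}(y_{\sigma^{-1}(l)},\dots,y_{\sigma^{-1}(l+r_2-1)})$. Consider the chain $$\Theta=\sum(-1)^{\gamma}\mu^{(1)}(y_{\sigma^{-1}(1)},\dots,y_{\sigma^{-1}(l-1)},\rho^{(2)},y_{\sigma^{-1}(l+r_2)},\dots,y_{\sigma^{-1}(r)}),$$ where $$\gamma=\alpha+|\mu^{(1)}|+(|\mu^{(2)}|-1)\sum_{m=1}^{l-1}|x_{\sigma^{-1}(m)}|,\qquad \alpha=\sum_{\substack{s<t\\ \sigma(s)>\sigma(t)}}|x_s||x_t|.$$ Then: (1) $\Theta$ is a cycle.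 (2) The homology class of $\Theta$ represents a well-defined element, i.e. one independent of the choices of the $y_i$ and the $\rho^{(2)}$, of the quotient $$\frac{H_{|\Gamma|+\sum_{i=1}^r|x_i|+1}(A)}{\sum\mu^{(1)}\bigl(x_{\sigma^{-1}(1)},\dots,x_{\sigma^{-1}(l-1)},H_{|\mu^{(2)}|+\sum_{i=1}^{r_2}|x_{\sigma^{-1}(l+i-1)}|+1}(A),x_{\sigma^{-1}(l+r_2)},\dots,x_{\sigma^{-1}(r)}\bigr)},$$ where the denominator is the sum, over the summands of $\Gamma$, of the indicated subspaces. (3) As the choices vary, the homology classes of the resulting cycles $\Theta$ run over all representatives in $H_{|\Gamma|+\sum_{i=1}^r|x_i|+1}(A)$ of that element of the quotient.
   Context: All operads are symmetric operads in graded $\Bbbk$-vector spaces and gradings are homological ($d$ has degree $-1$); $|x|$ is the degree of $x$. $\mathcal{F}(E)$ is the free operad on $E$, and $R\subset\mathcal{F}(E)^{(2)}$ is a sub-$\mathbb{S}$-module of the weight $2$ part (composites of exactly two generators). In the Sweedler-like notation $\Gamma=\sum(\mu^{(1)}\circ_l\mu^{(2)})\cdot\sigma$ all symbols depend on the summand: $\mu^{(1)}\in E(r_1)$, $\mu^{(2)}\in E(r_2)$ are homogeneous, $r_1+r_2-1=r$, $1\le l\le r_1$, $\sigma\in\mathbb{S}_r$, $\circ_l$ is the partial (infinitesimal) composition in the $l$-th input, and $|\mu^{(1)}|+|\mu^{(2)}|=|\Gamma|$. A DG-$\mathcal{O}$-algebra is a chain complex $A$ with an action of $\mathcal{O}$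 by maps $\mu\otimes a_1\otimes\cdots\otimes a_r\mapsto\mu(a_1,\dots,a_r)$ compatible with the differential by the Koszul sign rule. The right symmetric action satisfies $(\mu\cdot\sigma)(a_1,\dots,a_r)=(-1)^{\alpha}\mu(a_{\sigma^{-1}(1)},\dots,a_{\sigma^{-1}(r)})$ with $\alpha=\sum_{s<t,\,\sigma(s)>\sigma(t)}|a_s||a_t|$. The homology $H_*(A)$ inherits a graded $\mathcal{O}$-algebra structure. The element of the quotient in the claim is called the Massey product $\langle x_1,\dots,x_r\rangle_\Gamma$. *)

(* Defs.v *)
From HB Require Import structures.
From mathcomp Require Import all_boot all_order all_algebra all_fingroup.
From mathcomp Require Import zify ring.
From mathcomp Require Import generic_quotient ring_quotient boolp.

Set Implicit Arguments.
Unset Strict Implicit.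
Unset Printing Implicit Defensive.

Import GRing.Theory.
Local Open Scope ring_scope.
Local Open Scope quotient_scope.

(* Conventions.
   - A graded vector space is a family V : int -> lmodType k.
   - Compositions, actions and differentials take the index of their result as
     a free parameter and are required to vanish unless it is the expected one
     (the *_shape fields).  This is how transports along equalities between
     indices are avoided.
   - Inputs are numbered from 0. *)

(** * Subspaces and quotients *)

Section Quotients.
Variables (k : fieldType) (V : lmodType k).

Inductive span (P : V -> Prop) : V -> Prop :=
| span_gen v : P v -> span P v
| span_0 : span P 0
| span_lin a u v : span P u -> span P v -> span P (a *: u + v).

Variable P : V -> Prop.

Definition spanb : {pred V} := fun v => `[< span P v >].

Lemma spanbP v : reflect (span P v) (v \in spanb).
Proof. exact: asboolP. Qed.

Lemma spanb_submod_closed : submod_closed spanb.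
Proof.
split; first by apply/spanbP; exact: span_0.
by move=> a u v /spanbP hu /spanbP hv; apply/spanbP; exact: span_lin.
Qed.

HB.instance Definition _ := GRing.isSubmodClosed.Build k V spanb
  (GRing.submod_closed_semi spanb_submod_closed).

Definition lquot := Quotient.quot spanb.

HB.instance Definition _ := Choice.on lquot.
HB.instance Definition _ := GRing.Zmodule.on lquot.
HB.instance Definition _ := EqQuotient.on lquot.

Definition lproj (v : V) : lquot := \pi_lquot v.

Lemma lprojP u v : lproj u = lproj v <-> span P (u - v).
Proof.
split=> [/eqP h|h].
  by apply/spanbP; rewrite Quotient.idealrBE.
by apply/eqP; rewrite -Quotient.idealrBE; apply/spanbP.
Qed.

Lemma lproj_surj q : exists v, lproj v = q.
Proof. by exists (repr q); rewrite /lproj reprK. Qed.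

Lemma lprojD u v : lproj (u + v) = lproj u + lproj v.
Proof. exact: (Quotient.pi_add spanb). Qed.

Definition lquot_scale (a : k) (q : lquot) : lquot := lproj (a *: repr q).

Lemma lquot_scaleE a v : lquot_scale a (lproj v) = lproj (a *: v).
Proof.
apply/lprojP; rewrite -scalerBr -[_ *: _]addr0.
apply: span_lin; last exact: span_0.
by apply/lprojP; rewrite {1}/lproj reprK.
Qed.

Lemma lquot_scaleA a b q :
  lquot_scale a (lquot_scale b q) = lquot_scale (a * b) q.
Proof. by have [v <-] := lproj_surj q; rewrite !lquot_scaleE scalerA. Qed.

Lemma lquot_scale1 : left_id 1 lquot_scale.
Proof.
by move=> q; have [v <-] := lproj_surj q; rewrite lquot_scaleE scale1r.
Qed.

Lemma lquot_scaleDr : right_distributive lquot_scale +%R.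
Proof.
move=> a q q'; have [v <-] := lproj_surj q; have [v' <-] := lproj_surj q'.
by rewrite -lprojD !lquot_scaleE scalerDr lprojD.
Qed.

Lemma lquot_scaleDl q : {morph lquot_scale^~ q : a b / a + b}.
Proof.
move=> a b; have [v <-] := lproj_surj q.
by rewrite !lquot_scaleE scalerDl lprojD.
Qed.

HB.instance Definition _ := GRing.Zmodule_isLmodule.Build k lquot
  lquot_scaleA lquot_scale1 lquot_scaleDr lquot_scaleDl.

Lemma lproj_linear : linear lproj.
Proof. by move=> a u v; rewrite lprojD -lquot_scaleE. Qed.

HB.instance Definition _ := GRing.isLinear.Build k V lquot _ lproj
  (lproj_linear).

End Quotients.

(** * Homogeneous elements and Koszul signs *)

Definition gelt (k : fieldType) (V : int -> lmodType k) := {d : int & V d}.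

Definition gin (k : fieldType) (V : int -> lmodType k) (d : int) (v : V d) :
  gelt V := existT _ d v.

Definition gdeg (k : fieldType) (V : int -> lmodType k) (s : seq (gelt V)) :
  int := \sum_(a <- s) tag a.

Definition sgn (k : fieldType) (z : int) : k := (-1) ^ z.

Definition koszul_exp (n : nat) (deg : 'I_n -> int) (s : 'S_n) : int :=
  \sum_(p : 'I_n * 'I_n | (p.1 < p.2)%N && (s p.2 < s p.1)%N)
    deg p.1 * deg p.2.

Definition permute (T : Type) (n : nat) (s : 'S_n) (a : 'I_n -> T) : seq T :=
  [seq a ((s^-1)%g i) | i : 'I_n].

(** * Graded S-modules and operads *)

(* The product t * s of permutations is "t, then s" in MathComp, so smod_actM
   is the usual axiom of a right action. *)
Record smodule (k : fieldType) := SModule {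
  smod_sort :> nat -> int -> lmodType k;
  smod_act : forall n d, smod_sort n d -> 'S_n -> smod_sort n d;
  smod_act_linear : forall n d (s : 'S_n),
    linear (fun x : smod_sort n d => smod_act x s);
  smod_act1 : forall n d (x : smod_sort n d), smod_act x 1%g = x;
  smod_actM : forall n d (x : smod_sort n d) (s t : 'S_n),
    smod_act (smod_act x s) t = smod_act x (t * s)%g }.

Definition reduced (k : fieldType) (E : smodule k) : Prop :=
  forall d (x : E 0%N d), x = 0.

Definition is_smod_morph (k : fieldType) (M N : smodule k)
    (f : forall n d, M n d -> N n d) : Prop :=
  (forall n d, linear (@f n d)) /\
  (forall n d (x : M n d) (s : 'S_n),
     f n d (smod_act x s) = smod_act (f n d x) s).

Definition is_sub_smod (k : fieldType) (M : smodule k)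
    (R : forall n d, M n d -> Prop) : Prop :=
  [/\ forall n d, R n d 0,
      forall n d a (x y : M n d), R n d x -> R n d y -> R n d (a *: x + y)
    & forall n d (x : M n d) (s : 'S_n), R n d x -> R n d (smod_act x s)].

(* If y has arity n, the input q != i of x is the input [shift_input i n q] of
   the partial composite of x and y at i. *)
Definition shift_input (i n q : nat) : nat :=
  if (q < i)%N then q else (q + n).-1.

(* s' permutes like s, the input i being replaced by a block of n inputs. *)
Definition is_block_perm (m n p : nat) (i : 'I_m) (s : 'S_m) (s' : 'S_p) :=
  (forall (q : 'I_m) (j : 'I_p), q != i -> j = shift_input i n q :> nat ->
     s' j = shift_input (s i) n (s q) :> nat) /\
  (forall (q : 'I_n) (j : 'I_p), j = (i + q)%N :> nat ->
     s' j = (s i + q)%N :> nat).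

(* s' permutes the n inputs starting at i like s and fixes the other ones. *)
Definition is_inner_perm (n p i : nat) (s : 'S_n) (s' : 'S_p) :=
  (forall (q : 'I_n) (j : 'I_p), j = (i + q)%N :> nat ->
     s' j = (i + s q)%N :> nat) /\
  (forall j : 'I_p, (j < i)%N || (i + n <= j)%N -> s' j = j).

Record operad (k : fieldType) := Operad {
  op_smod :> smodule k;
  op_unit : op_smod 1%N 0;
  op_comp : forall m n p d e f,
    op_smod m d -> nat -> op_smod n e -> op_smod p f;
  op_comp_shape : forall m n p d e f (x : op_smod m d) i (y : op_smod n e),
    ~~ [&& (i < m)%N, p.+1 == (m + n)%N & f == d + e] ->
    op_comp p f x i y = 0;
  op_comp_linear_l : forall m n p d e f i (y : op_smod n e),
    linear (fun x : op_smod m d => op_comp p f x i y);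
  op_comp_linear_r : forall m n p d e f (x : op_smod m d) i,
    linear (fun y : op_smod n e => op_comp p f x i y);
  op_unit_l : forall n d (x : op_smod n d), op_comp n d op_unit 0%N x = x;
  op_unit_r : forall n d (x : op_smod n d) i, (i < n)%N ->
    op_comp n d x i op_unit = x;
  op_assoc_seq : forall l m n p q r d e f
      (x : op_smod l d) (y : op_smod m e) (z : op_smod n f) i j,
    (i < l)%N -> (j < m)%N ->
    p.+1 = (l + m)%N -> q.+1 = (m + n)%N -> r.+1 = (p + n)%N ->
    op_comp r (d + e + f) (op_comp p (d + e) x i y) (i + j)%N z =
    op_comp r (d + e + f) x i (op_comp q (e + f) y j z);
  op_assoc_par : forall l m n p q r d e f
      (x : op_smod l d) (y : op_smod m e) (z : op_smod n f) i j,
    (i < j < l)%N ->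
    p.+1 = (l + m)%N -> q.+1 = (l + n)%N -> r.+1 = (p + n)%N ->
    op_comp r (d + e + f) (op_comp p (d + e) x i y) (j + m).-1 z =
    sgn k (e * f) *:
      op_comp r (d + e + f) (op_comp q (d + f) x j z) i y;
  op_equiv_l : forall m n p d e (x : op_smod m d) (y : op_smod n e)
      (i : 'I_m) (s : 'S_m) (s' : 'S_p),
    p.+1 = (m + n)%N -> is_block_perm n i s s' ->
    op_comp p (d + e) (smod_act x s) i y =
    smod_act (op_comp p (d + e) x (s i) y) s';
  op_equiv_r : forall m n p d e (x : op_smod m d) (y : op_smod n e)
      (i : 'I_m) (s : 'S_n) (s' : 'S_p),
    p.+1 = (m + n)%N -> is_inner_perm i s s' ->
    op_comp p (d + e) x i (smod_act y s) =
    smod_act (op_comp p (d + e) x i y) s' }.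

Arguments op_unit {k} _.
Arguments op_comp {k _ m n} p {d e} f x i y.

Definition is_operad_morph (k : fieldType) (O P : operad k)
    (f : forall n d, O n d -> P n d) : Prop :=
  [/\ is_smod_morph f,
      f 1%N 0 (op_unit O) = op_unit P
    & forall m n p d e g (x : O m d) i (y : O n e),
        f p g (op_comp p g x i y) = op_comp p g (f m d x) i (f n e y)].

Definition is_free_operad (k : fieldType) (E : smodule k) (F : operad k)
    (iota : forall n d, E n d -> F n d) : Prop :=
  is_smod_morph iota /\
  forall (P : operad k) (f : forall n d, E n d -> P n d),
    is_smod_morph f ->
    exists g : forall n d, F n d -> P n d,
      [/\ is_operad_morph g,
          forall n d (x : E n d), g n d (iota n d x) = f n d x
        & forall g' : forall n d, F n d -> P n d,
            is_operad_morph g' ->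
            (forall n d (x : E n d), g' n d (iota n d x) = f n d x) ->
            forall n d (x : F n d), g' n d x = g n d x].

(* The weight w part of an operad generated by the image of gen: the linear
   combinations of composites of exactly w generators. *)
Inductive op_weight (k : fieldType) (E : smodule k) (O : operad k)
    (gen : forall n d, E n d -> O n d) :
    nat -> forall n d, O n d -> Prop :=
| weight_unit : op_weight gen 0 (op_unit O)
| weight_gen n d (x : E n d) : op_weight gen 1 (gen n d x)
| weight_comp u v m n p d e f (x : O m d) i (y : O n e) :
    op_weight gen u x -> op_weight gen v y ->
    op_weight gen (u + v) (op_comp p f x i y)
| weight_act w n d (x : O n d) (s : 'S_n) :
    op_weight gen w x -> op_weight gen w (smod_act x s)
| weight_0 w n d : op_weight gen w (0 : O n d)
| weight_lin w n d a (x y : O n d) :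
    op_weight gen w x -> op_weight gen w y -> op_weight gen w (a *: x + y).

Inductive op_ideal (k : fieldType) (O : operad k)
    (R : forall n d, O n d -> Prop) : forall n d, O n d -> Prop :=
| ideal_gen n d (x : O n d) : R n d x -> op_ideal R x
| ideal_comp_l m n p d e f (x : O m d) i (y : O n e) :
    op_ideal R x -> op_ideal R (op_comp p f x i y)
| ideal_comp_r m n p d e f (x : O m d) i (y : O n e) :
    op_ideal R y -> op_ideal R (op_comp p f x i y)
| ideal_act n d (x : O n d) (s : 'S_n) :
    op_ideal R x -> op_ideal R (smod_act x s)
| ideal_0 n d : op_ideal R (0 : O n d)
| ideal_lin n d a (x y : O n d) :
    op_ideal R x -> op_ideal R y -> op_ideal R (a *: x + y).

(* O = P(E, R): (F, iota) is the free operad on E, R is a sub-S-module of its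
   weight 2 part, and O is the quotient of F by the ideal (R) through proj. *)
Record quadratic_presentation (k : fieldType) (E : smodule k) (F O : operad k)
    (iota : forall n d, E n d -> F n d) (R : forall n d, F n d -> Prop)
    (proj : forall n d, F n d -> O n d) : Prop := QuadraticPresentation {
  pres_free : is_free_operad iota;
  pres_sub : is_sub_smod R;
  pres_weight2 : forall n d (x : F n d), R n d x -> op_weight iota 2 x;
  pres_morph : is_operad_morph proj;
  pres_surj : forall n d (y : O n d), exists x, proj n d x = y;
  pres_ker : forall n d (x : F n d), proj n d x = 0 <-> op_ideal R x }.

(** * The bar construction and Koszulness *)

Section Bar.
Variables (k : fieldType) (O : operad k).

(* Planar trees with numbered leaves.  [Node w x ts] is a vertex decorated by
   the suspension of x, where x has weight w, with list of inputs ts. *)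
Inductive tree : Type :=
| Leaf of nat
| Node (w n : nat) (d : int) of O n d & seq tree.

Fixpoint tree_deg (t : tree) : int :=
  match t with
  | Leaf _ => 0
  | Node _ _ d _ ts => d + 1 + foldr +%R 0 (map tree_deg ts)
  end.

Definition forest_deg (ts : seq tree) : int := \sum_(t <- ts) tree_deg t.

Fixpoint tree_weight (t : tree) : nat :=
  match t with
  | Leaf _ => 0
  | Node w _ _ _ ts => w + sumn (map tree_weight ts)
  end.

Fixpoint tree_vertices (t : tree) : nat :=
  match t with
  | Leaf _ => 0
  | Node _ _ _ _ ts => (sumn (map tree_vertices ts)).+1
  end.

Fixpoint tree_leaves (t : tree) : seq nat :=
  match t with
  | Leaf i => [:: i]
  | Node _ _ _ _ ts => flatten (map tree_leaves ts)
  end.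

(* Formal linear combinations. *)
Definition chain := seq (k * tree).

Definition eval_chain (V : lmodType k) (phi : tree -> V) (c : chain) : V :=
  \sum_(p <- c) p.1 *: phi p.2.

Inductive context : Type :=
| Hole
| Within (w n : nat) (d : int) of O n d & seq tree & context & seq tree.

Fixpoint plug (K : context) (t : tree) : tree :=
  match K with
  | Hole => t
  | Within w _ _ x l K' r => Node w x (l ++ plug K' t :: r)
  end.

(* The maps factoring through the sum, over isomorphism classes of trees, of
   the tensor products of the (suspended) decorations. *)
Definition balanced (V : lmodType k) (phi : tree -> V) : Prop :=
  (forall K w n d ts, linear (fun x : O n d => phi (plug K (Node w x ts)))) /\
  (forall K w n d (x : O n d) (s : 'S_n) (ts : n.-tuple tree),
     phi (plug K (Node w (smod_act x s) ts)) =
     sgn k (koszul_exp (fun i => tree_deg (tnth ts i)) s) *: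
       phi (plug K (Node w x (permute s (tnth ts))))).

(* Equality of the classes in that sum, through its universal property. *)
Definition chain_eq (c c' : chain) : Prop :=
  forall (V : lmodType k) (phi : tree -> V), balanced phi ->
    eval_chain phi c = eval_chain phi c'.

(* The differential contracts the internal edges in all possible ways.  With
   the vertices of a tree in depth-first order from the root, the child sy of
   the edge is first moved past the subtrees that separate it from its parent
   sx, and then the tensor product of sx and sy is sent to
   (-1)^|x| s(x o_i y). *)
Definition contract_root (w n : nat) (d : int) (x : O n d) (ts : seq tree) :
    chain :=
  flatten [seq match nth (Leaf 0) ts i with
    | Leaf _ => [::]
    | Node v m e y us =>
        [:: (sgn k (d + (e + 1) * forest_deg (take i ts)),
             Node (w + v) (op_comp (n + m).-1 (d + e) x i y)
               (take i ts ++ us ++ drop i.+1 ts))]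
    end | i <- iota 0 (size ts)].

Fixpoint bar_d (t : tree) : chain :=
  match t with
  | Leaf _ => [::]
  | Node w n d x ts =>
      let dts := map bar_d ts in
      contract_root w x ts ++
      flatten [seq
        [seq (sgn k (d + 1 + forest_deg (take i ts)) * p.1,
              Node w x (set_nth (Leaf 0) ts i p.2)) | p <- nth [::] dts i]
        | i <- iota 0 (size ts)]
  end.

Definition chain_d (c : chain) : chain :=
  flatten [seq [seq (p.1 * q.1, q.2) | q <- bar_d p.2] | p <- c].

Variables (E : smodule k) (gen : forall n d, E n d -> O n d).

(* The positivity of w says that decorations lie in the augmentation ideal. *)
Fixpoint tree_wf (t : tree) : Prop :=
  match t with
  | Leaf _ => True
  | Node w n _ x ts =>
      [/\ size ts = n, (0 < w)%N, op_weight gen w x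
        & foldr and True (map tree_wf ts)]
  end.

(* The arity r, weight w part of the bar construction, with s vertices. *)
Definition bar_chain (r w s : nat) (c : chain) : Prop :=
  foldr and True [seq
    [/\ tree_wf p.2, perm_eq (tree_leaves p.2) (iota 0 r),
        tree_weight p.2 = w & tree_vertices p.2 = s] | p : k * tree <- c].

(* The homology of the bar construction is concentrated on the diagonal, i.e.
   the inclusion of the Koszul dual cooperad, which is its diagonal homology,
   is a quasi-isomorphism. *)
Definition koszul : Prop :=
  forall (r w s : nat) (c : chain), s != w ->
    bar_chain r w s c -> chain_eq (chain_d c) [::] ->
    exists2 c', bar_chain r w s.+1 c' & chain_eq c (chain_d c').

End Bar.

(** * Complexes, algebras and homology *)

Record complex (k : fieldType) := Complex {
  cx_sort :> int -> lmodType k;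
  cx_d : forall i j, cx_sort i -> cx_sort j;
  cx_d_shape : forall i j (a : cx_sort i), i != j + 1 -> cx_d j a = 0;
  cx_d_linear : forall i j, linear (@cx_d i j);
  cx_dd : forall i j l (a : cx_sort i), cx_d l (cx_d j a) = 0 }.

Arguments cx_d {k _ i} j a.

Section Homology.
Variables (k : fieldType) (A : complex k).

Definition is_cycle (d : int) (a : A d) : Prop := cx_d (d - 1) a = 0.

Lemma cx_d0 i j : cx_d j (0 : A i) = 0.
Proof.
have := @cx_d_linear k A i j (-1) 0 0.
by rewrite scaler0 addr0 scaleN1r addNr.
Qed.

Section Degree.
Variable d : int.

Definition cycleb : {pred A d} := fun a => cx_d (d - 1) a == 0.

Lemma cycleb_submod_closed : submod_closed cycleb.
Proof.
split; first by apply/eqP; rewrite cx_d0.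
move=> a u v /eqP hu /eqP hv; apply/eqP.
by rewrite cx_d_linear hu hv scaler0 addr0.
Qed.

HB.instance Definition _ := GRing.isSubmodClosed.Build k (A d) cycleb
  (GRing.submod_closed_semi cycleb_submod_closed).

Record cycle := Cycle { cycle_val : A d; _ : cycle_val \in cycleb }.

HB.instance Definition _ := [isSub for cycle_val].
HB.instance Definition _ := [Choice of cycle by <:].
HB.instance Definition _ := [SubChoice_isSubLmodule of cycle by <:].

Definition is_boundary (z : cycle) : Prop :=
  exists b : A (d + 1), cycle_val z = cx_d d b.

Definition homology : lmodType k := lquot is_boundary.

Definition hclass (z : cycle) : homology := lproj is_boundary z.

Definition represents (a : A d) (h : homology) : Prop :=
  exists2 z, cycle_val z = a & hclass z = h.

Definition hrepr (h : homology) : cycle := repr h.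

Lemma hreprK h : hclass (hrepr h) = h.
Proof. exact: reprK. Qed.

Lemma hclassP (z z' : cycle) :
  hclass z = hclass z' <->
  exists b : A (d + 1), cycle_val z - cycle_val z' = cx_d d b.
Proof.
split=> [/lprojP | [b hb]]; last by apply/lprojP/span_gen; exists b.
suff h u : span is_boundary u -> is_boundary u by move/h.
elim=> {u} [//| |a u v _ [b hb] _ [b' hb']].
  by exists 0; rewrite cx_d0.
by exists (a *: b + b'); rewrite cx_d_linear -hb -hb'.
Qed.

End Degree.
End Homology.

Arguments cycle {k} A d.
Arguments homology {k} A d.

Record dgalg (k : fieldType) (O : operad k) := DGAlg {
  dg_cx :> complex k;
  dg_act : forall n d e, O n d -> seq (gelt dg_cx) -> dg_cx e;
  dg_act_shape : forall n d e (x : O n d) s,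
    ~~ ((size s == n) && (e == d + gdeg s)) -> dg_act e x s = 0;
  dg_act_linear_op : forall n d e s,
    linear (fun x : O n d => dg_act e x s);
  dg_act_linear : forall n d e f (x : O n d) s1 s2,
    linear (fun a : dg_cx f => dg_act e x (s1 ++ gin a :: s2));
  dg_act_unit : forall e (a : dg_cx e),
    dg_act e (op_unit O) [:: gin a] = a;
  dg_act_comp : forall m n p d e f g (x : O m d) i (y : O n e)
      (s1 s2 s3 : seq (gelt dg_cx)),
    size s1 = i -> size s2 = n -> (i + 1 + size s3)%N = m ->
    p.+1 = (m + n)%N -> f = e + gdeg s2 ->
    dg_act g (op_comp p (d + e) x i y) (s1 ++ s2 ++ s3) =
    sgn k (e * gdeg s1) *:
      dg_act g x (s1 ++ gin (dg_act f y s2) :: s3);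
  dg_act_sym : forall n d e (x : O n d) (s : 'S_n) (t : n.-tuple (gelt dg_cx)),
    dg_act e (smod_act x s) t =
    sgn k (koszul_exp (fun i => tag (tnth t i)) s) *:
      dg_act e x (permute s (tnth t));
  dg_act_d : forall n d e (x : O n d) (t : n.-tuple (gelt dg_cx)),
    e = d + gdeg t ->
    cx_d (e - 1) (dg_act e x t) =
    \sum_(i < n) sgn k (d + gdeg (take i t)) *:
      dg_act (e - 1) x (take i t ++
        gin (cx_d (tag (tnth t i) - 1) (tagged (tnth t i))) :: drop i.+1 t) }.

Arguments dg_act {k O} A {n d} e x s : rename.

Section HomologyAction.
Variables (k : fieldType) (O : operad k) (A : dgalg O).

Lemma dg_act_zero n d e f (x : O n d) s1 s2 :
  dg_act A e x (s1 ++ gin (0 : A f) :: s2) = 0.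
Proof.
have := dg_act_linear e x s1 s2 (-1) (0 : A f) 0.
by rewrite /= scaler0 addr0 scaleN1r addNr.
Qed.

Lemma dg_act_cycle n d e (x : O n d) (s : seq (gelt A)) :
  (forall i, (i < size s)%N -> forall a0, is_cycle (tagged (nth a0 s i))) ->
  dg_act A e x s \in @cycleb k A e.
Proof.
move=> hs; rewrite /cycleb /in_mem /=.
case hsh: ((size s == n) && (e == d + gdeg s)); last first.
  by rewrite dg_act_shape ?hsh // cx_d0.
have /andP[hn /eqP he] := hsh.
rewrite (dg_act_d x (t := Tuple hn)) //; apply/eqP; apply: big1 => i _.
have -> : cx_d (tag (tnth (Tuple hn) i) - 1) (tagged (tnth (Tuple hn) i)) = 0.
  set a0 := tnth (Tuple hn) i.
  rewrite /a0 (tnth_nth a0) /=; apply: hs.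
  by rewrite (eqP hn).
by rewrite dg_act_zero scaler0.
Qed.

Definition gcycles (s : seq (gelt (homology A))) : seq (gelt A) :=
  [seq gin (cycle_val (hrepr (tagged h))) | h <- s].

Lemma gcyclesP s i : (i < size (gcycles s))%N -> forall a0,
  is_cycle (tagged (nth a0 (gcycles s) i)).
Proof.
rewrite size_map => hi a0.
case: s hi => // h0 s hi.
rewrite (nth_map h0) //=.
by case: hrepr => a /= /eqP.
Qed.

(* The induced action on homology, computed on representing cycles; it does
   not depend on them by hact_represents below. *)
Definition hact n d e (x : O n d) (s : seq (gelt (homology A))) :
    homology A e :=
  hclass (Cycle (dg_act_cycle e x (@gcyclesP s))).

Definition all_cycles (s : seq (gelt A)) :=
  forall i, (i < size s)%N -> forall a0, is_cycle (tagged (nth a0 s i)).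

Lemma dg_act_boundary n d e f (x : O n d) s1 s2 (b : A (f + 1)) :
  all_cycles s1 -> all_cycles s2 ->
  exists b' : A (e + 1),
    dg_act A e x (s1 ++ gin (cx_d f b) :: s2) = cx_d e b'.
Proof.
move=> hs1 hs2.
case hsh: ((size (s1 ++ gin (cx_d f b) :: s2) == n) &&
           (e == d + gdeg (s1 ++ gin (cx_d f b) :: s2))); last first.
  by exists 0; rewrite dg_act_shape ?hsh // cx_d0.
have /andP[hn /eqP he] := hsh.
set s := s1 ++ gin b :: s2.
have hsn : size s == n by rewrite -(eqP hn) !size_cat.
have hes : e + 1 = d + gdeg s.
  by rewrite he /gdeg /s !big_cat /= !big_cons /=; ring.
have hlt : (size s1 < n)%N.
  by rewrite -(eqP hsn) size_cat /= addnS ltnS leq_addr.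
have /= hd := dg_act_d x (t := Tuple hsn) hes.
have nthE (i : 'I_n) : tnth (Tuple hsn) i = nth (gin b) s i.
  exact: tnth_nth.
move: hd; rewrite addrK (bigD1 (Ordinal hlt)) //= big1 ?addr0; last first.
  move=> i hi; rewrite nthE.
  have hcyc : is_cycle (tagged (nth (gin b) s i)).
    rewrite /s nth_cat; case: ltnP => [lt_i|le_i]; first exact: hs1.
    case hj: (i - size s1)%N => [|j] /=.
      by case/eqP: hi; apply: val_inj => /=; lia.
    apply: hs2; have := ltn_ord i.
    by rewrite -{2}(eqP hsn) size_cat /=; lia.
  by rewrite hcyc dg_act_zero scaler0.
rewrite nthE /= /s take_size_cat // drop_cat ltnNge leqnSn /= subSnn /=.
rewrite drop0 nth_cat ltnn subnn /= addrK.
set c := sgn k _ => hd.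
exists (c *: dg_act A (e + 1) x (s1 ++ gin b :: s2)).
have hc : c * c = 1 by rewrite /c /sgn -expfzMl mulrNN mulr1 exp1rz.
have hl : cx_d e (c *: dg_act A (e + 1) x (s1 ++ gin b :: s2)) =
          c *: cx_d e (dg_act A (e + 1) x (s1 ++ gin b :: s2)).
  by have := @cx_d_linear k A (e + 1) e c
       (dg_act A (e + 1) x (s1 ++ gin b :: s2)) 0;
     rewrite cx_d0 !addr0.
by rewrite hl hd scalerA hc scale1r.
Qed.

Definition gcycle := {d : int & cycle A d}.

Lemma hact_represents n d e (x : O n d) (zs : seq gcycle) :
  represents
    (dg_act A e x [seq gin (cycle_val (tagged z)) | z <- zs])
    (hact e x [seq gin (hclass (tagged z)) | z <- zs]).
Proof.
set vals := fun zs : seq gcycle => [seq gin (cycle_val (tagged z)) | z <- zs].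
set classes := fun zs : seq gcycle => [seq gin (hclass (tagged z)) | z <- zs].
have vals_cyc us : all_cycles (vals us).
  move=> i; rewrite size_map => hi a0.
  case: us hi => // u0 us hi; rewrite (nth_map u0) //=.
  by case: (tagged _) => a /= /eqP.
have key us s1 : all_cycles s1 -> exists b : A (e + 1),
    dg_act A e x (s1 ++ vals us) - dg_act A e x (s1 ++ gcycles (classes us)) =
    cx_d e b.
  elim: us s1 => [|[f z] us IH] s1 hs1.
    by exists 0; rewrite subrr cx_d0.
  set z' := hrepr (hclass z).
  have /hclassP[b hb] : hclass z = hclass z' by rewrite hreprK.
  have hs1' : all_cycles (rcons s1 (gin (cycle_val z'))).
    move=> i hi a0; move: hi; rewrite size_rcons ltnS leq_eqVlt nth_rcons.
    case: ltnP => [lt_i _|le_i]; first exact: hs1.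
    rewrite orbF => hi; rewrite hi /=.
    by case: (z') => a /= /eqP.
  have [b1 hb1] := dg_act_boundary e x b hs1 (vals_cyc us).
  have [b2] := IH _ hs1'; rewrite !cat_rcons => hb2.
  exists (1 *: b1 + b2).
  have /= hlin := dg_act_linear e x s1 (vals us) (-1) (cycle_val z')
    (cycle_val z).
  have hb' : cx_d f b = -1 *: cycle_val z' + cycle_val z.
    by rewrite -hb scaleN1r addrC.
  rewrite cx_d_linear scale1r -hb1 -hb2 hb' hlin scaleN1r /=.
  by rewrite [- _ + _]addrC addrA subrK.
rewrite -/(vals zs) -/(classes zs).
exists (Cycle (dg_act_cycle e x (vals_cyc zs))) => //.
apply/hclassP => /=.
by have [|b] := key zs [::]; last by exists b.
Qed.

End HomologyAction.

Arguments hact {k O} A {n d} e x s.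

(** * Massey products *)

(* A summand (mu1 o_slot mu2) . sperm of arity r and degree g. *)
Record summand (k : fieldType) (E : smodule k) (r : nat) (g : int) := Summand {
  ar1 : nat;
  ar2 : nat;
  deg1 : int;
  deg2 : int;
  mu1 : E ar1 deg1;
  mu2 : E ar2 deg2;
  slot : nat;
  sperm : 'S_r;
  slot_lt : (slot < ar1)%N;
  summand_arity : r.+1 = (ar1 + ar2)%N;
  summand_degree : g = deg1 + deg2 }.

Definition summand_val (k : fieldType) (E : smodule k) (F : operad k)
    (iota : forall n d, E n d -> F n d) (r : nat) (g : int)
    (t : summand E r g) : F r g :=
  smod_act (op_comp r g (iota _ _ (mu1 t)) (slot t) (iota _ _ (mu2 t)))
    (sperm t).

Section Massey.
Variables (k : fieldType) (E : smodule k) (O : operad k).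
Variable gen : forall n d, E n d -> O n d.
Variables (r : nat) (g : int).

Section Summand.
Variable t : summand E r g.

(* The inputs of mu2 and those of mu1, once b is put in its input slot, when
   the summand is applied to z_0, ..., z_(r-1). *)
Definition inner_args (T : Type) (z : 'I_r -> T) : seq T :=
  take (ar2 t) (drop (slot t) (permute (sperm t) z)).

Definition outer_args (T : Type) (z : 'I_r -> T) (b : T) : seq T :=
  take (slot t) (permute (sperm t) z) ++
  b :: drop (slot t + ar2 t) (permute (sperm t) z).

Variable e : 'I_r -> int.

Definition inner_deg : int := deg2 t + \sum_(i <- inner_args e) i.

Definition massey_exp : int :=
  koszul_exp e (sperm t) + deg1 t +
  (deg2 t - 1) * \sum_(i <- take (slot t) (permute (sperm t) e)) i.

End Summand.

Variables (A : dgalg O) (N : nat) (Gamma : 'I_N -> summand E r g).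
Variable e : 'I_r -> int.
Variable x : forall i, homology A (e i).

Definition massey_deg : int := g + \sum_i e i + 1.

Definition massey_defined : Prop :=
  forall j : 'I_N,
    hact A (inner_deg (Gamma j) e) (gen (mu2 (Gamma j)))
      (inner_args (Gamma j) (fun i => gin (x i))) = 0.

Section Choices.
Variables (y : forall i, A (e i)).
Variable rho : forall j : 'I_N, A (inner_deg (Gamma j) e + 1).

Definition massey_choice : Prop :=
  (forall i, represents (y i) (x i)) /\
  (forall j : 'I_N,
     cx_d (inner_deg (Gamma j) e) (rho j) =
     dg_act A (inner_deg (Gamma j) e) (gen (mu2 (Gamma j)))
       (inner_args (Gamma j) (fun i => gin (y i)))).

Definition massey_chain : A massey_deg :=
  \sum_(j < N) sgn k (massey_exp (Gamma j) e) *: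
    dg_act A massey_deg (gen (mu1 (Gamma j)))
      (outer_args (Gamma j) (fun i => gin (y i)) (gin (rho j))).

End Choices.

(* The union of the subspaces mu1(x, ..., x, H(A), x, ..., x).  Their sum is
   its span, and lquot massey_indet is the quotient by that span. *)
Definition massey_indet (h : homology A massey_deg) : Prop :=
  exists (j : 'I_N) (c : homology A (inner_deg (Gamma j) e + 1)),
    h = hact A massey_deg (gen (mu1 (Gamma j)))
          (outer_args (Gamma j) (fun i => gin (x i)) (gin c)).

End Massey.

(* Main.v *)
(* Since the operations commute with d up to sign, d Theta is the relation Gamma
   evaluated on the cycles y_i, which vanishes.  For independence, change one
   cycle at a time, from y_i0 to y_i0 + d b.  Each summand of Theta then changes
   by a boundary, a term mu1(y, ..., c, ..., y) with c a cycle, and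
   (-1)^(g + sum_(j < i0) |y_j|) times that summand of Gamma evaluated on the y_i
   with b in place of y_i0; the last contributions add up to zero.  Finally,
   adding cycles to the rho's reaches every class of the coset. *)
From mathcomp Require Import all_boot all_order all_algebra all_fingroup.
From mathcomp Require Import ring zify boolp.
Require Import Defs.

Set Implicit Arguments.
Unset Strict Implicit.
Unset Printing Implicit Defensive.

Import GRing.Theory.
Local Open Scope ring_scope.

(** * Signs as functions of the parity of an exponent *)

Section Signs.
Variable k : fieldType.
Implicit Types a b c : int.

Lemma sgnD a b : sgn k (a + b) = sgn k a * sgn k b.
Proof. by rewrite /sgn expfzDr // oppr_eq0 oner_eq0. Qed.

Lemma sgn_sqr a : sgn k a * sgn k a = 1.
Proof. by rewrite /sgn -expfzMl mulrNN mulr1 exp1rz. Qed.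

(** The congruence modulo 2 is carried by an explicit [c], so that comparing two signs becomes an
    identity in [int] that [ring] can check. *)
Lemma sgn_eq c a b : a = b + (c + c) -> sgn k a = sgn k b.
Proof. by move=> ->; rewrite !sgnD sgn_sqr mulr1. Qed.

Lemma sgnS a : sgn k (a + 1) = - sgn k a.
Proof. by rewrite sgnD {2}/sgn expr1z mulrN1. Qed.

End Signs.

(** * Koszul exponents and reordered lists of inputs *)

Section KoszulExponent.
Variables (n : nat) (deg : 'I_n -> int) (s : 'S_n) (i0 : 'I_n).

(* The inputs that i0 crosses are, modulo 2, those before i0 together with those
   that s sends before s i0. *)
Lemma koszul_exp_incr : exists c,
  koszul_exp (fun i => deg i + (i == i0)%:R) s +
    \sum_(j | (s j < s i0)%N) deg j =
  koszul_exp deg s + \sum_(j : 'I_n | (j < i0)%N) deg j + (c + c).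
Proof.
(* [c] and [c'] collect the inputs that cross [i0] from its right and from its left, [c''] those
   that stay on its left. The exponent grows by [c + c'], while the two sums are [c + c''] and
   [c' + c'']. *)
set c := \sum_(j : 'I_n | (i0 < j)%N && (s j < s i0)%N) deg j.
set c' := \sum_(j : 'I_n | (j < i0)%N && (s i0 < s j)%N) deg j.
set c'' := \sum_(j : 'I_n | (j < i0)%N && (s j < s i0)%N) deg j.
have sNi j : j != i0 -> s j != s i0 :> nat.
  by apply: contraNneq => /val_inj/perm_inj ->.
have hQ : \sum_(j | (s j < s i0)%N) deg j = c + c''.
  rewrite (bigID (fun j : 'I_n => (i0 < j)%N)) /=; congr (_ + _).
    by apply: eq_bigl => j; rewrite andbC.
  apply: eq_bigl => j; rewrite andbC; have [-> | ji] := eqVneq j i0.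
    by rewrite !ltnn andbF.
  by rewrite -leqNgt leq_eqVlt (negPf (ji : (j != i0 :> nat))).
have hP : \sum_(j : 'I_n | (j < i0)%N) deg j = c' + c''.
  rewrite (bigID (fun j => (s i0 < s j)%N)) /=; congr (_ + _).
  apply: eq_bigl => j; have [-> | ji] := eqVneq j i0.
    by rewrite !ltnn.
  by rewrite -leqNgt [(s j <= _)%N]leq_eqVlt (negPf (sNi _ ji)).
have hK : koszul_exp (fun i => deg i + (i == i0)%:R) s =
    koszul_exp deg s + c + c'.
  rewrite /koszul_exp.
  under eq_bigr => p /andP[hp _].
    have -> : (deg p.1 + (p.1 == i0)%:R) * (deg p.2 + (p.2 == i0)%:R) =
        deg p.1 * deg p.2 + (p.1 == i0)%:R * deg p.2 +
        (p.2 == i0)%:R * deg p.1.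
      (* The entries of a counted pair are distinct, so they are not both [i0]. *)
      have h : ((p.1 == i0)%:R * (p.2 == i0)%:R : int) = 0.
        case: eqP => [h1|]; last by rewrite mul0r.
        case: eqP => [h2|]; last by rewrite mulr0.
        by move: hp; rewrite h1 h2 ltnn.
      by rewrite mulrDl !mulrDr h addr0 [deg p.1 * _%:R]mulrC addrAC.
    over.
  rewrite !big_split /=; congr (_ + _ + _).
    (* Pairs with [i0] as first entry sum to [c]; those with [i0] as second entry, treated next, sum
       to [c']. *)
    rewrite -(pair_big_dep xpredT (fun i j : 'I_n => (i < j)%N && (s j < s i)%N)
      (fun i j => (i == i0)%:R * deg j)) /= (bigD1 i0) //= [X in _ + X]big1.
      by rewrite addr0; apply: eq_bigr => j _; rewrite eqxx mul1r.
    by move=> i /negPf hi; apply: big1 => j _; rewrite hi mul0r.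
  rewrite -(pair_big_dep xpredT (fun i j : 'I_n => (i < j)%N && (s j < s i)%N)
    (fun i j => (j == i0)%:R * deg i)) /= (exchange_big_dep xpredT) //=.
  rewrite (bigD1 i0) //= [X in _ + X]big1 ?addr0.
    by apply: eq_bigr => j _; rewrite eqxx mul1r.
  by move=> i /negPf hi; apply: big1 => j _; rewrite hi mul0r.
by exists c; rewrite hK hQ hP; ring.
Qed.

(** Every list of arguments becomes the image of one list of indices, [permute s id], which can then
    be cut at the slot and at [i0]. *)
Lemma permuteE (T : Type) (f : 'I_n -> T) : permute s f = map f (permute s id).
Proof. by rewrite /permute /image_mem -map_comp. Qed.

Lemma size_permute (T : Type) (f : 'I_n -> T) : size (permute s f) = n.
Proof. by rewrite size_map -cardE card_ord. Qed.

Lemma permute_uniq : uniq (permute s id).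
Proof. by rewrite map_inj_uniq ?enum_uniq //; exact: perm_inj. Qed.

Lemma mem_permute i : i \in permute s id.
Proof. by rewrite -[i](permK s); apply: map_f; rewrite mem_enum. Qed.

Lemma index_permute i : index i (permute s id) = s i.
Proof.
rewrite -{1}[i](permK s) /permute /image_mem.
by rewrite (index_map (@perm_inj _ _)) index_enum_ord.
Qed.

(** The index [j] sits at position [s j] of [permute s id], so [s j < s i0] means that [j] lies in
    the prefix [p1]. *)
Lemma sum_before p1 p2 (F : 'I_n -> int) : permute s id = p1 ++ i0 :: p2 ->
  \sum_(j | (s j < s i0)%N) F j = \sum_(j <- p1) F j.
Proof.
move=> hp; have := permute_uniq; rewrite hp cat_uniq => /and3P[u1 hN u2].
rewrite big_uniq //; apply: eq_bigl => j.
have hi0 : i0 \notin p1.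
  by apply: contraNN hN => h; apply/hasP; exists i0; rewrite ?mem_head.
rewrite -!index_permute hp !index_cat (negPf hi0) /= eqxx addn0.
by case: ifP => hj; rewrite ?index_mem // ltnNge leq_addr.
Qed.

End KoszulExponent.

(** * Linearity of the differential and representatives of homology classes *)

Section Complexes.
Variables (k : fieldType) (A : complex k).

Lemma cx_dZ i j (c : k) (a : A i) : cx_d j (c *: a) = c *: cx_d j a.
Proof. by rewrite -[c *: a]addr0 cx_d_linear cx_d0 addr0. Qed.

Lemma cx_dD i j (a b : A i) : cx_d j (a + b) = cx_d j a + cx_d j b.
Proof. by rewrite -[a]scale1r cx_d_linear !scale1r. Qed.

Lemma cx_dB i j (a b : A i) : cx_d j (a - b) = cx_d j a - cx_d j b.
Proof. by rewrite -scaleN1r cx_dD cx_dZ scaleN1r. Qed.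

Lemma cx_d_sum i j I (s : seq I) (a : I -> A i) :
  cx_d j (\sum_(l <- s) a l) = \sum_(l <- s) cx_d j (a l).
Proof.
elim: s => [|l s IH]; first by rewrite !big_nil cx_d0.
by rewrite !big_cons cx_dD IH.
Qed.

(** [gin] packs an element with its degree, so that the target degree can be changed along an
    equality without a transport. *)
Lemma gin_cx_d l i j (a : A l) : i = j -> gin (cx_d i a) = gin (cx_d j a).
Proof. by move->. Qed.

Lemma cycleP d (z : cycle A d) : is_cycle (cycle_val z).
Proof. by case: z => a /= /eqP. Qed.

Lemma gdeg_cat (s1 s2 : seq (gelt A)) : gdeg (s1 ++ s2) = gdeg s1 + gdeg s2.
Proof. by rewrite /gdeg big_cat. Qed.

Lemma gdeg_cons a (s : seq (gelt A)) : gdeg (a :: s) = tag a + gdeg s.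
Proof. by rewrite /gdeg big_cons. Qed.

Lemma represents_lin d (c : k) (a b : A d) h h' :
  represents a h -> represents b h' ->
  represents (c *: a + b) (c *: h + h').
Proof.
move=> [z <- <-] [z' <- <-]; exists (c *: z + z') => //.
by rewrite /hclass linearP.
Qed.

Lemma represents0 d : represents (0 : A d) 0.
Proof. by exists 0; rewrite // /hclass linear0. Qed.

Lemma represents_boundary d (a : A (d + 1)) : represents (cx_d d a) 0.
Proof.
have hc : cx_d d a \in @cycleb k A d by apply/eqP; rewrite cx_dd.
exists (Cycle hc) => //; rewrite -(linear0 (@lproj k (cycle A d) _)).
by apply/hclassP; exists a; rewrite subr0.
Qed.

Lemma represents_inj d (a : A d) h h' :
  represents a h -> represents a h' -> h = h'.
Proof. by move=> [z <- <-] [z' /val_inj -> <-]. Qed.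

End Complexes.

(** * Multilinearity of the action and its Leibniz rule *)

Section Action.
Variables (k : fieldType) (O : operad k) (A : dgalg O).

Lemma all_cycles_map I (s : seq I) (f : I -> gelt A) :
  (forall i, is_cycle (tagged (f i))) -> all_cycles (map f s).
Proof.
move=> hf i; rewrite size_map => hi a0.
by case: s hi => // i0 s hi; rewrite (nth_map i0).
Qed.

Section Linear.
Variables (n : nat) (d e f : int) (x : O n d) (s1 s2 : seq (gelt A)).

Lemma dg_actZ (c : k) (a : A f) :
  dg_act A e x (s1 ++ gin (c *: a) :: s2) =
  c *: dg_act A e x (s1 ++ gin a :: s2).
Proof.
have /= := dg_act_linear e x s1 s2 c a 0.
by rewrite addr0 dg_act_zero addr0.
Qed.

Lemma dg_actD (a b : A f) :
  dg_act A e x (s1 ++ gin (a + b) :: s2) =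
  dg_act A e x (s1 ++ gin a :: s2) + dg_act A e x (s1 ++ gin b :: s2).
Proof.
by have /= := dg_act_linear e x s1 s2 1 a b; rewrite !scale1r.
Qed.

Lemma dg_actB (a b : A f) :
  dg_act A e x (s1 ++ gin (a - b) :: s2) =
  dg_act A e x (s1 ++ gin a :: s2) - dg_act A e x (s1 ++ gin b :: s2).
Proof. by rewrite dg_actD -scaleN1r dg_actZ scaleN1r. Qed.

End Linear.

Lemma dg_act_op0 n d e (a : seq (gelt A)) : dg_act A e (0 : O n d) a = 0.
Proof.
have := dg_act_linear_op e a (-1) (0 : O n d) 0.
by rewrite /= scaler0 addr0 scaleN1r addNr.
Qed.

Lemma dg_act_sum n d e I (s : seq I) (x : I -> O n d) (a : seq (gelt A)) :
  dg_act A e (\sum_(i <- s) x i) a = \sum_(i <- s) dg_act A e (x i) a.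
Proof.
elim: s => [|i s IH]; first by rewrite !big_nil dg_act_op0.
rewrite !big_cons -IH.
by have := dg_act_linear_op e a 1 (x i) (\sum_(j <- s) x j); rewrite /= !scale1r.
Qed.

Section Leibniz.
Variables (n : nat) (d e : int) (x : O n d).

(** The target degree [e'] stays a parameter so that [e + 1 - 1] can be rewritten into [e]; [a0] is
    a default value for [nth]. *)
Let leibniz_term (s : seq (gelt A)) a0 (i : nat) :=
  fun e' => sgn k (d + gdeg (take i s)) *:
    dg_act A e' x (take i s ++
      gin (cx_d (tag (nth a0 s i) - 1) (tagged (nth a0 s i))) :: drop i.+1 s).

Let leibniz (s : seq (gelt A)) a0 : size s = n -> e + 1 = d + gdeg s ->
  cx_d e (dg_act A (e + 1) x s) = \sum_(i < n) leibniz_term s a0 i e.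
Proof.
move=> /eqP hs he.
suff h : cx_d (e + 1 - 1) (dg_act A (e + 1) x s) =
    \sum_(i < n) leibniz_term s a0 i (e + 1 - 1) by rewrite addrK in h.
rewrite (dg_act_d x (t := Tuple hs)) //.
by apply: eq_bigr => i _; rewrite (tnth_nth a0).
Qed.

Let leibniz_term_cycle (s : seq (gelt A)) a0 i :
  is_cycle (tagged (nth a0 s i)) -> leibniz_term s a0 i e = 0.
Proof. by move=> h; rewrite /leibniz_term h dg_act_zero scaler0. Qed.

Let leibniz_term_split s1 s2 (f : int) (a : A (f + 1)) a0 :
  leibniz_term (s1 ++ gin a :: s2) a0 (size s1) e =
  sgn k (d + gdeg s1) *:
    dg_act A e x (s1 ++ gin (cx_d f a) :: s2).
Proof.
rewrite /leibniz_term take_size_cat // nth_cat ltnn subnn /=.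
rewrite -[s1 ++ gin a :: s2]cat_rcons drop_size_cat ?size_rcons //.
by rewrite (gin_cx_d (j := f)) ?addrK.
Qed.

(** The Leibniz terms that differentiate an entry of [s1] or [s2] vanish, these entries being
    cycles. *)
Lemma leibniz1 s1 s2 (f : int) (a : A (f + 1)) :
  all_cycles s1 -> all_cycles s2 ->
  cx_d e (dg_act A (e + 1) x (s1 ++ gin a :: s2)) =
  sgn k (d + gdeg s1) *: dg_act A e x (s1 ++ gin (cx_d f a) :: s2).
Proof.
move=> h1 h2.
(* If arity or degree does not fit, both sides are zero: replacing [a] by its differential keeps the
   arity and lowers both degrees by one. *)
case hsh: ((size (s1 ++ gin a :: s2) == n) &&
           (e + 1 == d + gdeg (s1 ++ gin a :: s2))); last first.
  rewrite dg_act_shape ?hsh // cx_d0 dg_act_shape ?scaler0 //.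
  apply: contraFN hsh => /andP[/eqP hs /eqP he]; apply/andP; split; apply/eqP.
    by rewrite -hs !size_cat /= ?size_cat.
  by rewrite he !(gdeg_cat, gdeg_cons) /=; ring.
have /andP[/eqP hs /eqP he] := hsh.
have := leibniz (gin a) hs he.
have hlt : (size s1 < n)%N by rewrite -hs size_cat /= addnS ltnS leq_addr.
rewrite (bigD1 (Ordinal hlt)) //= leibniz_term_split big1 ?addr0.
  by [].
move=> i hi; apply: leibniz_term_cycle; rewrite nth_cat.
case: ltnP => h; first exact: h1.
have hn : i <> size s1 :> nat by apply/eqP.
have hi' := ltn_ord i; rewrite -[X in (_ < X)%N]hs size_cat /= in hi'.
(* The difference is positive; written as a successor, it lets [nth] step over [a] into [s2]. *)
have -> : (i - size s1)%N = (i - size s1).-1.+1 by lia.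
by apply: h2; lia.
Qed.

(** Serves the case where [b] and [rho'] are both inputs of [mu1]. Two terms survive, and the second
    sign also counts the degree [f + 1] of [a]. *)
Lemma leibniz2 s1 s2 s3 (f f' : int) (a : A (f + 1)) (b : A (f' + 1)) :
  all_cycles s1 -> all_cycles s2 -> all_cycles s3 ->
  cx_d e (dg_act A (e + 1) x (s1 ++ gin a :: s2 ++ gin b :: s3)) =
  sgn k (d + gdeg s1) *:
    dg_act A e x (s1 ++ gin (cx_d f a) :: s2 ++ gin b :: s3) +
  sgn k (d + gdeg s1 + f + 1 + gdeg s2) *:
    dg_act A e x (s1 ++ gin a :: s2 ++ gin (cx_d f' b) :: s3).
Proof.
move=> h1 h2 h3.
case hsh: ((size (s1 ++ gin a :: s2 ++ gin b :: s3) == n) &&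
           (e + 1 == d + gdeg (s1 ++ gin a :: s2 ++ gin b :: s3))); last first.
  rewrite dg_act_shape ?hsh // cx_d0 !dg_act_shape ?scaler0 ?addr0 //.
    apply: contraFN hsh => /andP[/eqP hs /eqP he]; apply/andP; split; apply/eqP.
      by rewrite -hs !size_cat /= ?size_cat.
    by rewrite he !(gdeg_cat, gdeg_cons) /=; ring.
  apply: contraFN hsh => /andP[/eqP hs /eqP he]; apply/andP; split; apply/eqP.
    by rewrite -hs !size_cat /= ?size_cat.
  by rewrite he !(gdeg_cat, gdeg_cons) /=; ring.
have /andP[/eqP hs /eqP he] := hsh.
have := leibniz (gin a) hs he.
have hs' : (size s1 + (size s2 + (size s3).+1).+1)%N = n.
  by rewrite -hs !size_cat /= ?size_cat.
have hlt : (size s1 < n)%N by lia.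
have hlt' : (size s1 + 1 + size s2 < n)%N by lia.
rewrite (bigD1 (Ordinal hlt)) //= (bigD1 (Ordinal hlt')) /=; last first.
  by apply/eqP => /(congr1 val) /=; lia.
rewrite leibniz_term_split big1 ?addr0 => [|i /andP[hi hi']].
  move=> ->; congr (_ + _).
  have -> : (size s1 + 1 + size s2)%N = size (s1 ++ gin a :: s2).
    by rewrite size_cat /=; lia.
  have -> : s1 ++ gin a :: s2 ++ gin b :: s3 =
      (s1 ++ gin a :: s2) ++ gin b :: s3 by rewrite -catA.
  rewrite leibniz_term_split.
  rewrite -catA gdeg_cat gdeg_cons /=; congr (sgn k _ *: _).
  by rewrite !addrA.
have {}hi : i <> size s1 :> nat by apply/eqP.
have {}hi' : i <> (size s1 + 1 + size s2)%N :> nat by apply/eqP.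
have hn := ltn_ord i; rewrite -[X in (_ < X)%N]hs' in hn.
apply: leibniz_term_cycle; rewrite nth_cat.
case: ltnP => h; first exact: h1.
have -> : (i - size s1)%N = (i - size s1).-1.+1 by lia.
rewrite /= nth_cat; case: ltnP => h'; first exact: h2.
have -> : ((i - size s1).-1 - size s2)%N = ((i - size s1).-1 - size s2).-1.+1.
  by lia.
by apply: h3; lia.
Qed.

End Leibniz.

(** Freeing the degree [h] of the composite lets it be the degree of the relation, which is equal to
    [deg1 t + deg2 t] only propositionally. *)
Lemma dg_act_comp_eq m n p d e f g h (x : O m d) i (y : O n e)
    (s1 s2 s3 : seq (gelt A)) :
  size s1 = i -> size s2 = n -> (i + 1 + size s3)%N = m ->
  p.+1 = (m + n)%N -> f = e + gdeg s2 -> h = d + e ->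
  dg_act A g (op_comp p h x i y) (s1 ++ s2 ++ s3) =
  sgn k (e * gdeg s1) *: dg_act A g x (s1 ++ gin (dg_act A f y s2) :: s3).
Proof. by move=> h1 h2 h3 h4 h5 ->; exact: dg_act_comp. Qed.

End Action.

(** Here [z] will be the term that occurs with opposite signs in the relation and in a boundary,
    when the changed cycle is an input of [mu1]. *)
Lemma addr_sub_cancel (V : zmodType) (a b c z : V) :
  a + c - b = - z + (a - b) + (z + c).
Proof. by rewrite addrACA addNr add0r addrAC. Qed.

Section MasseyProducts.
Variables (k : fieldType) (E : smodule k) (O : operad k).
Variable gen : forall n d, E n d -> O n d.
Variables (r : nat) (g : int) (A : dgalg O) (e : 'I_r -> int).

Let elts (y : forall i, A (e i)) i : gelt A := gin (y i).

Let gdeg_elts y (q : seq 'I_r) : gdeg (map (elts y) q) = \sum_(i <- q) e i.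
Proof. by rewrite /gdeg big_map. Qed.

(** * One summand of the relation, evaluated on cycles *)

Section Summand.
Variable t : summand E r g.

(** The three blocks of indices are the inputs of [mu1] before the slot, those of [mu2], and those
    of [mu1] after the slot. *)
Let q1 := take (slot t) (permute (sperm t) id).
Let q2 := take (ar2 t) (drop (slot t) (permute (sperm t) id)).
Let q3 := drop (slot t + ar2 t) (permute (sperm t) id).

Let permute_split : permute (sperm t) id = q1 ++ q2 ++ q3.
Proof. by rewrite /q1 /q2 /q3 addnC -drop_drop !cat_take_drop. Qed.

Lemma inner_argsE T (f : 'I_r -> T) : inner_args t f = map f q2.
Proof. by rewrite /inner_args permuteE -map_drop -map_take. Qed.

Lemma outer_argsE T (f : 'I_r -> T) b :
  outer_args t f b = map f q1 ++ b :: map f q3.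
Proof. by rewrite /outer_args permuteE -map_drop -map_take. Qed.

Let size_q1 : size q1 = slot t.
Proof.
rewrite size_take size_permute; case: ltnP => //.
by have := slot_lt t; have := summand_arity t; lia.
Qed.

Let size_q2 : size q2 = ar2 t.
Proof.
rewrite size_take size_drop size_permute; case: ltnP => //.
by have := slot_lt t; have := summand_arity t; lia.
Qed.

Let size_q3 : (slot t + 1 + size q3)%N = ar1 t.
Proof.
rewrite size_drop size_permute.
by have := slot_lt t; have := summand_arity t; lia.
Qed.

Definition summand_op : O r g :=
  smod_act (op_comp r g (gen (mu1 t)) (slot t) (gen (mu2 t))) (sperm t).

(** The first sign comes from permuting the inputs, the second from moving [mu2 t] past those before
    the slot. [h] is a parameter because the inner degree is [q] or [q + 1] according to where [b]
    is inserted. *)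
Let act_summand D h (f : 'I_r -> gelt A) :
  h = deg2 t + gdeg (map f q2) ->
  dg_act A D summand_op (mktuple f) =
  (sgn k (koszul_exp (fun i => tag (f i)) (sperm t)) *
   sgn k (deg2 t * gdeg (map f q1))) *:
    dg_act A D (gen (mu1 t))
      (map f q1 ++ gin (dg_act A h (gen (mu2 t)) (map f q2)) :: map f q3).
Proof.
move=> hh; rewrite /summand_op dg_act_sym -scalerA.
have -> : tnth (mktuple f) = f by apply: funext => i; rewrite tnth_mktuple.
congr (_ *: _); rewrite permuteE permute_split !map_cat.
by apply: dg_act_comp_eq; rewrite ?size_map //;
  [exact: summand_arity | exact: summand_degree].
Qed.

Let sum_q1 : \sum_(i <- take (slot t) (permute (sperm t) e)) i =
  \sum_(i <- q1) e i.
Proof. by rewrite permuteE -map_take big_map. Qed.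

Let q := inner_deg t e.

Let inner_degE : q = deg2 t + \sum_(i <- q2) e i.
Proof. by rewrite /q /inner_deg inner_argsE big_map. Qed.

(** [D] is free so that the term can be taken in a degree of the form [D + 1], as in the Leibniz
    lemmas; [massey_deg] has this form. *)
Definition massey_term D (y : forall i, A (e i)) (rho : A (q + 1)) : A D :=
  sgn k (massey_exp t e) *:
    dg_act A D (gen (mu1 t)) (outer_args t (elts y) (gin rho)).

Lemma massey_term_d D y rho : (forall i, is_cycle (y i)) ->
  cx_d q rho = dg_act A q (gen (mu2 t)) (inner_args t (elts y)) ->
  cx_d D (massey_term (D + 1) y rho) =
  dg_act A D summand_op (mktuple (elts y)).
Proof.
move=> hy hrho; rewrite /massey_term cx_dZ outer_argsE.
have hcyc qq : all_cycles (map (elts y) qq) by exact: all_cycles_map.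
rewrite leibniz1 // hrho inner_argsE scalerA.
have hdeg : q = deg2 t + gdeg (map (elts y) q2) by rewrite gdeg_elts.
rewrite (act_summand _ hdeg) gdeg_elts; congr (_ *: _).
(* The Leibniz sign adds [deg1 t] and the degrees of [q1] to [massey_exp]: the former then occurs
   twice, and the latter turn the coefficient [deg2 t - 1] into [deg2 t]. *)
rewrite -!sgnD /massey_exp sum_q1; apply: (sgn_eq k (c := deg1 t)).
by rewrite /=; ring.
Qed.

Lemma massey_termB D y rho rho' :
  massey_term D y rho' - massey_term D y rho = massey_term D y (rho' - rho).
Proof. by rewrite /massey_term -scalerBr !outer_argsE -dg_actB. Qed.

(** * Effect on a summand of replacing one cycle by a homologous one *)

Section ChangeOneCycle.
Variables (D : int) (i0 : 'I_r) (b : A (e i0 + 1)).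
Variables y y' : forall i, A (e i).
Variables rho rho' : A (q + 1).
Hypothesis hy : forall i, is_cycle (y i).
Hypothesis hyi : forall i, i != i0 -> y' i = y i.
Hypothesis hyi0 : y' i0 = y i0 + cx_d (e i0) b.
Hypothesis hrho :
  cx_d q rho = dg_act A q (gen (mu2 t)) (inner_args t (elts y)).
Hypothesis hrho' :
  cx_d q rho' = dg_act A q (gen (mu2 t)) (inner_args t (elts y')).

Let yb (i : 'I_r) : gelt A := if i == i0 then gin b else gin (y i).

Let tag_yb i : tag (yb i) = e i + (i == i0)%:R.
Proof. by rewrite /yb; case: eqP => [->|_]; rewrite //= addr0. Qed.

Let all_y u : all_cycles (map (elts y) u).
Proof. exact: all_cycles_map. Qed.

Let map_y' u : i0 \notin u -> map (elts y') u = map (elts y) u.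
Proof.
move=> hu; apply/eq_in_map => i iu; rewrite /elts hyi //.
by apply: contraNneq hu => <-.
Qed.

Let map_yb u : i0 \notin u -> map yb u = map (elts y) u.
Proof.
move=> hu; apply/eq_in_map => i iu; rewrite /yb.
by case: eqP => // hi; rewrite -hi iu in hu.
Qed.

Let yb_i0 : yb i0 = gin b.
Proof. by rewrite /yb eqxx. Qed.

Let y'_i0 : elts y' i0 = gin (y i0 + cx_d (e i0) b).
Proof. by rewrite /elts hyi0. Qed.

Let before := \sum_(j : 'I_r | (j < i0)%N) e j.

Let degD a : g + a = deg1 t + deg2 t + a.
Proof. by rewrite -summand_degree. Qed.

Let koszul_yb u v : permute (sperm t) id = u ++ i0 :: v -> exists c,
  koszul_exp (fun i => tag (yb i)) (sperm t) =
  koszul_exp e (sperm t) + before + (c + c) - \sum_(j <- u) e j.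
Proof.
move=> huv; have [c hc] := koszul_exp_incr e (sperm t) i0.
exists c; rewrite -hc (sum_before e huv) addrK.
by congr koszul_exp; apply: funext => i; exact: tag_yb.
Qed.

Let notin_split u v : permute (sperm t) id = u ++ i0 :: v ->
  (i0 \notin u) && (i0 \notin v).
Proof.
move=> huv; have := permute_uniq (sperm t).
by rewrite huv cat_uniq /= negb_or => /and4P[_ /andP[-> _] -> _].
Qed.

(** Named because it is proved separately in each of the three blocks where [i0] may lie. The cycle
    [c] contributes to the indeterminacy. *)
Let change_formula := exists (c : A (q + 1)) (a : A (D + 1 + 1)),
  cx_d q c = 0 /\
  massey_term (D + 1) y' rho' - massey_term (D + 1) y rho =
    sgn k (g + before) *: dg_act A (D + 1) summand_op (mktuple yb) +
    dg_act A (D + 1) (gen (mu1 t)) (outer_args t (elts y) (gin c)) +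
    cx_d (D + 1) a.

(** Both [rho' - rho] and [tau *: m] have as boundary [mu2] with [d b] in place of [y i0], so they
    differ by a cycle. Inserting [m] into [mu1] gives, up to sign, the summand evaluated on [yb]. *)
Let change_inner : i0 \in q2 -> change_formula.
Proof.
move=> hi; have [u [v huv]] : exists u v, q2 = u ++ i0 :: v.
  by case/splitPr: hi => u v; exists u, v.
have hp : permute (sperm t) id = (q1 ++ u) ++ i0 :: (v ++ q3).
  by rewrite permute_split huv -!catA.
have [c hc] := koszul_yb hp.
have := notin_split hp; rewrite !mem_cat !negb_or.
move=> /andP[/andP[n1 nu] /andP[nv n3]].
set m := dg_act A (q + 1) (gen (mu2 t))
  (map (elts y) u ++ gin b :: map (elts y) v).
set tau := sgn k (deg2 t + \sum_(i <- u) e i).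
set sig := sgn k (massey_exp t e).
exists (sig *: (rho' - rho - tau *: m)), 0; split.
  rewrite cx_dZ cx_dB cx_dZ.
  have -> : cx_d q (rho' - rho) = dg_act A q (gen (mu2 t))
      (map (elts y) u ++ gin (cx_d (e i0) b) :: map (elts y) v).
    rewrite cx_dB hrho hrho' !inner_argsE huv !map_cat /= y'_i0 !map_y' //.
    by rewrite dg_actD addrC addKr.
  rewrite leibniz1 // gdeg_elts.
  by rewrite scalerA sgn_sqr scale1r subrr scaler0.
have hdeg : q + 1 = deg2 t + gdeg (map yb q2).
  rewrite inner_degE huv map_cat /= yb_i0 !map_yb // gdeg_cat gdeg_cons.
  by rewrite !gdeg_elts big_cat big_cons /=; ring.
have hsgn : sig * tau = sgn k (g + before) *
    (sgn k (koszul_exp (fun i => tag (yb i)) (sperm t)) *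
     sgn k (deg2 t * \sum_(i <- q1) e i)).
  rewrite /sig /tau -!(sgnD k) hc /massey_exp sum_q1 degD big_cat /=.
  by apply: (sgn_eq k (c := \sum_(i <- u) e i - before - c)); ring.
have -> : massey_term (D + 1) y' rho' = massey_term (D + 1) y rho'.
  by rewrite /massey_term !outer_argsE !map_y'.
rewrite massey_termB /massey_term outer_argsE (act_summand _ hdeg).
rewrite [in dg_act A (q + 1) _ _]huv map_cat /= yb_i0 !map_yb // -/m.
move: (rho' - rho) => R.
rewrite outer_argsE dg_actZ dg_actB dg_actZ -/sig cx_d0 addr0.
set M := dg_act A _ _ (_ ++ gin m :: _).
rewrite scalerA scalerBr scalerA.
by rewrite gdeg_elts -hsgn [RHS]addrC subrK.
Qed.

(** The inputs of [mu2] do not change, so [rho' - rho] is a cycle. The Leibniz rule for [mu1]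
    applied to [b] and [rho'] trades the new term, containing [d b], for the summand evaluated on
    [yb], up to a boundary. *)
Let change_left : i0 \in q1 -> change_formula.
Proof.
move=> hi; have [u [v huv]] : exists u v, q1 = u ++ i0 :: v.
  by case/splitPr: hi => u v; exists u, v.
have hp : permute (sperm t) id = u ++ i0 :: (v ++ q2 ++ q3).
  by rewrite permute_split huv -!catA.
have [c hc] := koszul_yb hp.
have := notin_split hp; rewrite !mem_cat !negb_or.
move=> /andP[nu /and3P[nv n2 n3]].
set sig := sgn k (massey_exp t e).
set tau := sgn k (deg1 t + \sum_(i <- u) e i).
set tau' := sgn k (deg1 t + \sum_(i <- u) e i + e i0 + 1 + \sum_(i <- v) e i).
(* The [+ 1] on the right appears because [mu2 t] passes [b], whose degree exceeds that of [y i0] by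
   one. The minus sign comes from moving the [B] term across the Leibniz formula. *)
have hsgn : - (sig * tau * tau') = sgn k (g + before) *
    (sgn k (koszul_exp (fun i => tag (yb i)) (sperm t)) *
     sgn k (deg2 t * (\sum_(i <- q1) e i + 1))).
  rewrite /sig /tau /tau' -!(sgnD k) -sgnS hc /massey_exp sum_q1 degD huv.
  rewrite big_cat big_cons /=.
  apply: (sgn_eq k
    (c := deg1 t + \sum_(i <- u) e i + 1 - deg2 t - before - c)).
  by ring.
pose act z1 z2 := dg_act A (D + 1) (gen (mu1 t))
  (map (elts y) u ++ z1 :: map (elts y) v ++ z2 :: map (elts y) q3).
(* Two bracketings of one list, to expose either varying input to the linearity lemmas. *)
have act_assoc z1 z2 : act z1 z2 = dg_act A (D + 1) (gen (mu1 t))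
    ((map (elts y) u ++ z1 :: map (elts y) v) ++ z2 :: map (elts y) q3).
  by rewrite /act -catA.
set B := dg_act A q (gen (mu2 t)) (map (elts y) q2).
have hrB : cx_d q rho = B by rewrite hrho inner_argsE.
have hrB' : cx_d q rho' = B by rewrite hrho' inner_argsE map_y'.
set a := dg_act A (D + 1 + 1) (gen (mu1 t))
  (map (elts y) u ++ gin b :: map (elts y) v ++ gin rho' :: map (elts y) q3).
have ha : cx_d (D + 1) a =
    tau' *: act (gin b) (gin B) + tau *: act (gin (cx_d (e i0) b)) (gin rho').
  by rewrite /a leibniz2 // hrB' !gdeg_elts [LHS]addrC.
exists (sig *: (rho' - rho)), ((sig * tau) *: a); split.
  by rewrite cx_dZ cx_dB hrB hrB' subrr scaler0.
have hdeg : q = deg2 t + gdeg (map yb q2).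
  by rewrite map_yb // gdeg_elts inner_degE.
have -> : dg_act A (D + 1) summand_op (mktuple yb) =
    (sgn k (koszul_exp (fun i => tag (yb i)) (sperm t)) *
     sgn k (deg2 t * (\sum_(i <- q1) e i + 1))) *: act (gin b) (gin B).
  rewrite (act_summand _ hdeg) [map yb q1](_ : _ =
    map (elts y) u ++ gin b :: map (elts y) v).
    rewrite !map_yb // -act_assoc gdeg_cat gdeg_cons !gdeg_elts huv.
    rewrite big_cat big_cons /=; congr ((_ * sgn k (_ * _)) *: _); ring.
  by rewrite huv map_cat /= yb_i0 !map_yb.
have -> : massey_term (D + 1) y' rho' =
    sig *: (act (gin (y i0)) (gin rho') +
            act (gin (cx_d (e i0) b)) (gin rho')).
  rewrite /massey_term outer_argsE huv map_cat /= y'_i0 !map_y' // -catA.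
  by rewrite /= dg_actD.
have hrest z :
    dg_act A (D + 1) (gen (mu1 t)) (outer_args t (elts y) z) =
    act (gin (y i0)) z.
  by rewrite outer_argsE act_assoc huv map_cat.
rewrite /massey_term !hrest -/sig.
rewrite [act _ (gin (sig *: _))]act_assoc dg_actZ dg_actB -!act_assoc.
rewrite cx_dZ ha scalerA -hsgn scaleNr !scalerDr scalerN !scalerA.
rewrite -[sig * tau * tau]mulrA sgn_sqr mulr1.
exact: addr_sub_cancel.
Qed.

(** The argument of [change_left], with [b] now to the right of [rho']: the differential crosses
    [rho'] to reach [b], whence the [q + 1] in [tau']. *)
Let change_right : i0 \in q3 -> change_formula.
Proof.
move=> hi; have [u [v huv]] : exists u v, q3 = u ++ i0 :: v.
  by case/splitPr: hi => u v; exists u, v.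
have hp : permute (sperm t) id = (q1 ++ q2 ++ u) ++ i0 :: v.
  by rewrite permute_split huv -!catA.
have [c hc] := koszul_yb hp.
have := notin_split hp; rewrite !mem_cat !negb_or.
move=> /andP[/and3P[n1 n2 nu] nv].
set sig := sgn k (massey_exp t e).
set tau := sgn k (deg1 t + \sum_(i <- q1) e i).
set tau' := sgn k (deg1 t + \sum_(i <- q1) e i + q + 1 + \sum_(i <- u) e i).
have hsgn : - (sig * tau' * tau) = sgn k (g + before) *
    (sgn k (koszul_exp (fun i => tag (yb i)) (sperm t)) *
     sgn k (deg2 t * \sum_(i <- q1) e i)).
  rewrite /sig /tau /tau' -!(sgnD k) -sgnS hc /massey_exp sum_q1 degD.
  rewrite inner_degE !big_cat /=.
  apply: (sgn_eq k (c := 1 + deg1 t + \sum_(i <- q1) e i +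
    \sum_(i <- q2) e i + \sum_(i <- u) e i - before - c)).
  by ring.
pose act z1 z2 := dg_act A (D + 1) (gen (mu1 t))
  (map (elts y) q1 ++ z1 :: map (elts y) u ++ z2 :: map (elts y) v).
have act_assoc z1 z2 : act z1 z2 = dg_act A (D + 1) (gen (mu1 t))
    ((map (elts y) q1 ++ z1 :: map (elts y) u) ++ z2 :: map (elts y) v).
  by rewrite /act -catA.
set B := dg_act A q (gen (mu2 t)) (map (elts y) q2).
have hrB : cx_d q rho = B by rewrite hrho inner_argsE.
have hrB' : cx_d q rho' = B by rewrite hrho' inner_argsE map_y'.
set a := dg_act A (D + 1 + 1) (gen (mu1 t))
  (map (elts y) q1 ++ gin rho' :: map (elts y) u ++ gin b :: map (elts y) v).
have ha : cx_d (D + 1) a =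
    tau *: act (gin B) (gin b) + tau' *: act (gin rho') (gin (cx_d (e i0) b)).
  by rewrite /a leibniz2 // hrB' !gdeg_elts.
exists (sig *: (rho' - rho)), ((sig * tau') *: a); split.
  by rewrite cx_dZ cx_dB hrB hrB' subrr scaler0.
have hdeg : q = deg2 t + gdeg (map yb q2).
  by rewrite map_yb // gdeg_elts inner_degE.
have -> : dg_act A (D + 1) summand_op (mktuple yb) =
    (sgn k (koszul_exp (fun i => tag (yb i)) (sperm t)) *
     sgn k (deg2 t * \sum_(i <- q1) e i)) *: act (gin B) (gin b).
  rewrite (act_summand _ hdeg) [map yb q3](_ : _ =
    map (elts y) u ++ gin b :: map (elts y) v).
    by rewrite !map_yb // gdeg_elts.
  by rewrite huv map_cat /= yb_i0 !map_yb.
have -> : massey_term (D + 1) y' rho' =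
    sig *: (act (gin rho') (gin (y i0)) +
            act (gin rho') (gin (cx_d (e i0) b))).
  rewrite /massey_term outer_argsE huv map_cat /= y'_i0 !map_y' //.
  by rewrite !act_assoc -dg_actD -catA.
have hrest z :
    dg_act A (D + 1) (gen (mu1 t)) (outer_args t (elts y) z) =
    act z (gin (y i0)).
  by rewrite outer_argsE huv map_cat.
rewrite /massey_term !hrest -/sig.
rewrite [act (gin (sig *: _)) _]/act dg_actZ dg_actB.
rewrite cx_dZ ha scalerA -hsgn scaleNr !scalerDr scalerN !scalerA.
rewrite -[sig * tau' * tau']mulrA sgn_sqr mulr1.
exact: addr_sub_cancel.
Qed.

(* The sign does not depend on the summand, so that the first term vanishes once
   summed over a relation. *)
Lemma massey_term_change :
  exists (c : A (q + 1)) (a : A (D + 1 + 1)),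
    cx_d q c = 0 /\
    massey_term (D + 1) y' rho' - massey_term (D + 1) y rho =
      sgn k (g + before) *: dg_act A (D + 1) summand_op (mktuple yb) +
      dg_act A (D + 1) (gen (mu1 t)) (outer_args t (elts y) (gin c)) +
      cx_d (D + 1) a.
Proof.
have := mem_permute (sperm t) i0; rewrite permute_split !mem_cat.
case/or3P; [exact: change_left | exact: change_inner | exact: change_right].
Qed.

End ChangeOneCycle.
End Summand.

(** * Sums over the relation: cycles, independence of choices, representatives *)

Section Relation.
Variables (N : nat) (Gamma : 'I_N -> summand E r g).
Variable x : forall i, homology A (e i).
Hypothesis relation_act : forall D s,
  \sum_(j < N) dg_act A D (summand_op (Gamma j)) s = 0.
Hypothesis x_defined : massey_defined gen Gamma x.

Let Theta (y : forall i, A (e i)) rho : A (massey_deg g e) :=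
  massey_chain gen (Gamma := Gamma) y rho.

Let is_choice y (rho : forall j, A (inner_deg (Gamma j) e + 1)) :=
  massey_choice gen x y rho.

Let inner j := inner_deg (Gamma j) e.

Let vals (z : forall i, cycle A (e i)) i : A (e i) := cycle_val (z i).

Lemma massey_chain_cycle y rho :
  is_choice y rho -> is_cycle (Theta y rho).
Proof.
move=> [hy hrho]; rewrite /is_cycle addrK /Theta /massey_chain cx_d_sum.
rewrite -[RHS](relation_act (g + \sum_i e i) (mktuple (elts y))).
apply: eq_bigr => j _; apply: massey_term_d; last exact: hrho.
by move=> i; have [z <- _] := hy i; exact: cycleP.
Qed.

(** The axiom of choice turns the existential in [represents] into a family of cycles, which can be
    changed one entry at a time. *)
Lemma choice_vals y rho : is_choice y rho ->
  exists2 z, y = vals z & forall i, hclass (z i) = x i.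
Proof.
move=> [hy _]; have h i := cid2 (hy i).
exists (fun i => s2val (h i)) => [|i]; last by case: (h i).
by apply: functional_extensionality_dep => i; rewrite /vals; case: (h i).
Qed.

(** Identifies the class obtained by inserting a cycle in the slot as a generator of
    [massey_indet]. *)
Lemma represents_outer z j (c : cycle A (inner j + 1)) :
  (forall i, hclass (z i) = x i) ->
  represents
    (dg_act A (massey_deg g e) (gen (mu1 (Gamma j)))
      (outer_args (Gamma j) (elts (vals z)) (gin (cycle_val c))))
    (hact A (massey_deg g e) (gen (mu1 (Gamma j)))
      (outer_args (Gamma j) (fun i => gin (x i)) (gin (hclass c)))).
Proof.
move=> hz; pose gz i : gcycle A := existT _ (e i) (z i).
have := hact_represents (massey_deg g e) (gen (mu1 (Gamma j)))
  (outer_args (Gamma j) gz (existT _ _ c)).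
rewrite !outer_argsE !map_cat /= -!map_comp.
have -> : (fun i => gin (x i)) = (fun i => gin (hclass (z i))) :> (_ -> gelt _).
  by apply: funext => i; rewrite hz.
by [].
Qed.

(** By [x_defined], [mu2] of the representatives is a boundary; choice then picks a bounding element
    for each summand. *)
Lemma massey_choice_exists z : (forall i, hclass (z i) = x i) ->
  exists rho, is_choice (vals z) rho.
Proof.
move=> hz; pose gz i : gcycle A := existT _ (e i) (z i).
have h j : exists a : A (inner j + 1), cx_d (inner j) a =
    dg_act A (inner j) (gen (mu2 (Gamma j)))
      (inner_args (Gamma j) (elts (vals z))).
  have := hact_represents (inner j) (gen (mu2 (Gamma j)))
    (inner_args (Gamma j) gz).
  have := x_defined j; rewrite !inner_argsE -!map_comp.
  have -> : (fun i => gin (x i)) = (fun i => gin (hclass (z i)))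
      :> (_ -> gelt _) by apply: funext => i; rewrite hz.
  move=> /= -> [w <-].
  rewrite -(linear0 (@lproj k (cycle A (inner j)) _)) => /hclassP[a ha].
  by exists a; rewrite -ha subr0.
have h' j := cid (h j).
exists (fun j => sval (h' j)); split=> [i|j]; last by case: (h' j).
by exists (z i).
Qed.

(** Stated for chains, so that a difference of two values of [Theta] can be treated summand by
    summand although a single summand is in general not a cycle. *)
Let negligible (a : A (massey_deg g e)) :=
  exists2 h, represents a h & span (massey_indet gen Gamma x) h.

Let negligible_lin c a b :
  negligible a -> negligible b -> negligible (c *: a + b).
Proof.
move=> [h ha sh] [h' hb sh']; exists (c *: h + h'); last exact: span_lin.
exact: represents_lin.
Qed.

Let negligible0 : negligible 0.
Proof. by exists 0; [exact: represents0 | exact: span_0]. Qed.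

Let negligibleD a b : negligible a -> negligible b -> negligible (a + b).
Proof. by rewrite -{2}[a]scale1r; exact: negligible_lin. Qed.

Let negligibleZ c a : negligible a -> negligible (c *: a).
Proof. by move=> ha; rewrite -[c *: a]addr0; exact: negligible_lin. Qed.

Let negligible_sum I (s : seq I) (a : I -> A (massey_deg g e)) :
  (forall i, negligible (a i)) -> negligible (\sum_(i <- s) a i).
Proof.
move=> ha; elim: s => [|i s IH]; first by rewrite big_nil.
by rewrite big_cons; exact: negligibleD.
Qed.

Let negligible_boundary (a : A (massey_deg g e + 1)) :
  negligible (cx_d (massey_deg g e) a).
Proof. by exists 0; [exact: represents_boundary | exact: span_0]. Qed.

Let negligible_outer z j (c : A (inner j + 1)) :
  (forall i, hclass (z i) = x i) -> cx_d (inner j) c = 0 ->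
  negligible (dg_act A (massey_deg g e) (gen (mu1 (Gamma j)))
    (outer_args (Gamma j) (elts (vals z)) (gin c))).
Proof.
move=> hz hc.
have hc' : c \in @cycleb k A (inner j + 1).
  by apply/eqP; rewrite addrK.
exists (hact A (massey_deg g e) (gen (mu1 (Gamma j)))
  (outer_args (Gamma j) (fun i => gin (x i)) (gin (hclass (Cycle hc'))))).
  exact: (represents_outer (Cycle hc')).
by apply: span_gen; exists j, (hclass (Cycle hc')).
Qed.

Lemma massey_change_rho z rho rho' : (forall i, hclass (z i) = x i) ->
  is_choice (vals z) rho -> is_choice (vals z) rho' ->
  negligible (Theta (vals z) rho' - Theta (vals z) rho).
Proof.
move=> hz [_ hr] [_ hr']; rewrite /Theta /massey_chain -sumrB.
apply: negligible_sum => j; rewrite massey_termB.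
apply: negligibleZ; apply: negligible_outer => //.
by rewrite cx_dB hr hr' subrr.
Qed.

Lemma massey_change_cycle z z' i0 rho rho' :
  (forall i, hclass (z i) = x i) -> (forall i, hclass (z' i) = x i) ->
  (forall i, i != i0 -> z' i = z i) ->
  is_choice (vals z) rho -> is_choice (vals z') rho' ->
  negligible (Theta (vals z') rho' - Theta (vals z) rho).
Proof.
move=> hz hz' hi [_ hr] [_ hr'].
have /hclassP[b hb] : hclass (z' i0) = hclass (z i0) by rewrite hz hz'.
pose yb i : gelt A := if i == i0 then gin b else gin (vals z i).
pose s := sgn k (g + \sum_(j : 'I_r | (j < i0)%N) e j).
(* The relation evaluated on [yb] is zero as a whole; subtracting it cancels the first term of
   [massey_term_change] in each summand. *)
have -> : Theta (vals z') rho' - Theta (vals z) rho =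
    Theta (vals z') rho' - Theta (vals z) rho -
    s *: \sum_(j < N)
      dg_act A (massey_deg g e) (summand_op (Gamma j)) (mktuple yb).
  by rewrite relation_act scaler0 subr0.
rewrite scaler_sumr -!sumrB; apply: negligible_sum => j.
have [i|i /hi hii||c [a [hc ->]]] := massey_term_change (g + \sum_i e i)
  (i0 := i0) (b := b) (y := vals z) (y' := vals z') _ _ _ (hr j) (hr' j).
- exact: cycleP.
- by rewrite /vals hii.
- by rewrite -hb addrC subrK.
rewrite -[X in X - _]addrA [X in X - _]addrC addrK.
by apply: negligibleD; [exact: negligible_outer | exact: negligible_boundary].
Qed.

Lemma massey_indep z z' rho rho' :
  (forall i, hclass (z i) = x i) -> (forall i, hclass (z' i) = x i) ->
  is_choice (vals z) rho -> is_choice (vals z') rho' ->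
  negligible (Theta (vals z') rho' - Theta (vals z) rho).
Proof.
move=> hz + hrho.
(* Induction on the bound [n] below which [w] may differ from [z]. *)
suff h n w sigma : (forall i, hclass (w i) = x i) ->
    is_choice (vals w) sigma ->
    (forall i : 'I_r, (n <= i)%N -> w i = z i) ->
    negligible (Theta (vals w) sigma - Theta (vals z) rho).
  by move=> hz' hrho'; apply: (h r) => // i; rewrite leqNgt ltn_ord.
elim: n w sigma => [|n IH] w sigma hw hsigma hwz.
  have ewz : w = z by apply: functional_extensionality_dep => i; exact: hwz.
  by rewrite ewz in hw hsigma *; exact: massey_change_rho.
case: (ltnP n r) => hn; last first.
  by apply: IH => // i hi; have := ltn_ord i; rewrite ltnNge (leq_trans hn).
pose i0 := Ordinal hn.
(* Resetting entry [n] splits the difference into one change of cycle, from [w'] to [w], and the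
   induction hypothesis for [w']. *)
pose w' i := if i == i0 then z i else w i.
have hw' i : hclass (w' i) = x i by rewrite /w'; case: eqP.
have [sigma' hsigma'] := massey_choice_exists hw'.
rewrite -(subrKA (Theta (vals w') sigma')).
apply: negligibleD.
  apply: (@massey_change_cycle _ _ i0) => // i /negPf hi.
  by rewrite /w' hi.
apply: IH => // i hi; rewrite /w'; case: eqP => // hi0.
apply: hwz; rewrite ltn_neqAle hi andbT.
by apply: contra_notN hi0 => /eqP hni; exact: val_inj.
Qed.

(** Linearity in the slot merges all generators with the same [j], so one cycle per summand
    suffices. *)
Lemma span_massey_indet z h : (forall i, hclass (z i) = x i) ->
  span (massey_indet gen Gamma x) h ->
  exists c : forall j, cycle A (inner j + 1),
    represents (\sum_(j < N) dg_act A (massey_deg g e) (gen (mu1 (Gamma j)))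
      (outer_args (Gamma j) (elts (vals z)) (gin (cycle_val (c j))))) h.
Proof.
move=> hz; elim=> {h} [h [j [c ->]]||a h h' _ [c hc] _ [c' hc']].
- pose w j : cycle A (inner j + 1) := 0.
  exists (dfwith w (hrepr c)).
  rewrite (bigD1 j) //= dfwith_in big1 ?addr0 => [|j' hj].
    by have := represents_outer (hrepr c) hz; rewrite hreprK.
  by rewrite dfwith_out 1?eq_sym // outer_argsE dg_act_zero.
- exists (fun j => 0); rewrite big1; first exact: represents0.
  by move=> j _; rewrite outer_argsE dg_act_zero.
exists (fun j => a *: c j + c' j).
rewrite (eq_bigr (fun j =>
  a *: dg_act A (massey_deg g e) (gen (mu1 (Gamma j)))
    (outer_args (Gamma j) (elts (vals z)) (gin (cycle_val (c j)))) +
  dg_act A (massey_deg g e) (gen (mu1 (Gamma j)))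
    (outer_args (Gamma j) (elts (vals z)) (gin (cycle_val (c' j)))))).
  by rewrite big_split -scaler_sumr; exact: represents_lin.
by move=> j _; rewrite !outer_argsE; exact: dg_act_linear.
Qed.

Lemma massey_product :
  exists M : lquot (massey_indet gen Gamma x),
    (forall y rho h, is_choice y rho ->
       represents (Theta y rho) h -> lproj (massey_indet gen Gamma x) h = M) /\
    (forall h : homology A (massey_deg g e),
       lproj (massey_indet gen Gamma x) h = M ->
       exists y rho, is_choice y rho /\ represents (Theta y rho) h).
Proof.
pose z i := hrepr (x i).
have hz i : hclass (z i) = x i by exact: hreprK.
have [rho hrho] := massey_choice_exists hz.
have hc : Theta (vals z) rho \in @cycleb k A (massey_deg g e).
  by apply/eqP; exact: massey_chain_cycle hrho.
set h0 := hclass (Cycle hc).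
have hh0 : represents (Theta (vals z) rho) h0 by exists (Cycle hc).
exists (lproj _ h0); split=> [y rho' h hrho' hh | h /lprojP hh].
  have [z' ey hz'] := choice_vals hrho'; rewrite ey in hrho' hh.
  have [h' hh' sh'] := massey_indep hz hz' hrho hrho'.
  apply/lprojP; suff -> : h - h0 = h' by [].
  apply: represents_inj hh'.
  by rewrite -!scaleN1r ![_ + -1 *: _]addrC; exact: represents_lin.
have [c hcr] := span_massey_indet hz hh.
(* This sign squares to 1, so it cancels the one with which [c j] enters [Theta]. *)
pose s j := sgn k (massey_exp (Gamma j) e).
exists (vals z), (fun j => s j *: cycle_val (c j) + rho j); split.
  case: hrho => hy hr; split=> // j.
  have hcj : cx_d (inner j) (cycle_val (c j)) = 0.
    by have := cycleP (c j); rewrite /is_cycle addrK.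
  by rewrite cx_d_linear hcj scaler0 add0r; exact: hr.
have -> : Theta (vals z) (fun j => s j *: cycle_val (c j) + rho j) =
    \sum_(j < N) dg_act A (massey_deg g e) (gen (mu1 (Gamma j)))
      (outer_args (Gamma j) (elts (vals z)) (gin (cycle_val (c j)))) +
    Theta (vals z) rho.
  rewrite /Theta /massey_chain -big_split /=; apply: eq_bigr => j _.
  rewrite !outer_argsE dg_actD dg_actZ scalerDr scalerA.
  by rewrite /s sgn_sqr scale1r.
rewrite -[h](subrK h0) -[X in represents (X + _)]scale1r.
by rewrite -[X in represents _ (X + _)]scale1r; exact: represents_lin.
Qed.

End Relation.
End MasseyProducts.

(** * Massey products over a quadratic presentation *)

Theorem proposition2p3 (k : fieldType) (hk : [pchar k] =i pred0)
    (E : smodule k) (hE : reduced E)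
    (F O : operad k)
    (iota : forall n d, E n d -> F n d)
    (R : forall n d, F n d -> Prop)
    (proj : forall n d, F n d -> O n d)
    (hO : quadratic_presentation iota R proj)
    (hkoszul : koszul (fun n d (m : E n d) => proj n d (iota n d m)))
    (r : nat) (g : int) (N : nat) (Gamma : 'I_N -> summand E r g)
    (hGamma : R r g (\sum_(j < N) summand_val iota (Gamma j)))
    (A : dgalg O)
    (e : 'I_r -> int) (x : forall i, homology A (e i))
    (hx : massey_defined (fun n d (m : E n d) => proj n d (iota n d m))
            Gamma x) :
  let gen := fun n d (m : E n d) => proj n d (iota n d m) in
  let Theta := massey_chain gen (A := A) (Gamma := Gamma) (e := e) in
  (forall y rho, massey_choice gen x y rho -> is_cycle (Theta y rho)) /\
  exists M : lquot (massey_indet gen Gamma x),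
    (forall y rho h, massey_choice gen x y rho ->
       represents (Theta y rho) h -> lproj (massey_indet gen Gamma x) h = M) /\
    (forall h : homology A (massey_deg g e),
       lproj (massey_indet gen Gamma x) h = M ->
       exists y rho, massey_choice gen x y rho /\ represents (Theta y rho) h).
Proof.
move=> gen Theta.
have [[proj_lin proj_act] _ proj_comp] := pres_morph hO.
have projD (a b : F r g) : proj r g (a + b) = proj r g a + proj r g b.
  by rewrite -[a]scale1r proj_lin !scale1r.
have proj0 : proj r g 0 = 0.
  by apply: (addrI (proj r g 0)); rewrite -projD !addr0.
(* As [proj] is a morphism of operads, these operations add up to the image of an element of [R],
   which is zero. *)
have relation_act D s :
    \sum_(j < N) dg_act A D (summand_op gen (Gamma j)) s = 0.
  rewrite -dg_act_sum.
  have -> : \sum_(j < N) summand_op gen (Gamma j) =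
      proj r g (\sum_(j < N) summand_val iota (Gamma j)).
    rewrite (big_morph _ projD proj0); apply: eq_bigr => j _.
    by rewrite /summand_val proj_act proj_comp.
  have -> : proj r g (\sum_(j < N) summand_val iota (Gamma j)) = 0.
    by apply/(pres_ker hO)/ideal_gen.
  exact: dg_act_op0.
split; last exact: massey_product.
exact: massey_chain_cycle.
Qed.
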